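(* Let $m,n$ be positive integers and let $\mathbf{A}$ be an $m\times n$ random Gaussian matrix. Let $\mathbf{W}\in\mathbb{R}^{n\times n}$ be a (possibly random) symmetric matrix with all eigenvalues in $[0,1]$ that is statistically independent of $\mathbf{A}$. Let $\boldsymbol{\xi}\in\mathbb{R}^n$ be a fixed vector with $\boldsymbol{\xi}\in\mathcal{R}(\mathbf{W})$. If $m<\operatorname{rank}(\mathbf{W})$ and $\boldsymbol{\xi}\notin\mathcal{N}(\mathbf{I}-\mathbf{W})$, then with probability $1$, $\boldsymbol{\xi}$ is not a minimizer of the optimization problem $$\text{minimize } \ \boldsymbol{x}^\top(\mathbf{I}-\mathbf{W})\mathbf{W}^\dagger\boldsymbol{x}\quad\text{subject to}\quad \mathbf{A}\boldsymbol{x}=\mathbf{A}\boldsymbol{\xi},\ \ \boldsymbol{x}\in\mathcal{R}(\mathbf{W}).$$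
   Context: A random Gaussian matrix is an $m\times n$ matrix whose entries are i.i.d. Gaussian random variables with mean $0$ and variance $1/m$. $\mathcal{R}(\cdot)$ and $\mathcal{N}(\cdot)$ denote range and null space, $\mathbf{W}^\dagger$ is the Moore–Penrose pseudoinverse, and $\mathbf{I}$ is the $n\times n$ identity. The matrix $\mathbf{W}$ may be deterministic; if it is random, the stated conditions on $\mathbf{W}$ are assumed to hold almost surely. *)

(* Defs.v *)
From HB Require Import structures.
From mathcomp Require Import all_boot all_order all_algebra.
From mathcomp Require Import all_classical all_reals all_analysis.

Set Implicit Arguments.
Unset Strict Implicit.
Unset Printing Implicit Defensive.

Import Order.TTheory GRing.Theory Num.Theory.
Import numFieldNormedType.Exports.

Local Open Scope classical_set_scope.
Local Open Scope ring_scope.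

(* Matrices act on column vectors; [mxrange] and [mxnull] are therefore the
   column-side notions, unlike MathComp's row-space conventions. *)
Definition mxrange (R : realType) (m n : nat) (M : 'M[R]_(m, n)) :
  set 'cV[R]_m := [set M *m y | y in [set: 'cV[R]_n]].

Definition mxnull (R : realType) (m n : nat) (M : 'M[R]_(m, n)) :
  set 'cV[R]_n := [set x | M *m x = 0].

Section MoorePenrose.
Variable R : realType.

(* The four Penrose conditions. *)
Definition is_pinv (m n : nat) (M : 'M[R]_(m, n)) (X : 'M[R]_(n, m)) : Prop :=
  [/\ M *m X *m M = M,
      X *m M *m X = X,
      (M *m X)^T = M *m X &
      (X *m M)^T = X *m M].

(* The unique matrix satisfying the Penrose conditions: see [pinvP] and
   [is_pinv_uniq].  MathComp's [pinvmx] is only a one-sided partial inverse. *)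
Definition pinv (m n : nat) (M : 'M[R]_(m, n)) : 'M[R]_(n, m) :=
  xget 0 [set X | is_pinv M X].

Lemma gram_unitmx (m n : nat) (B : 'M[R]_(m, n)) :
  row_free B -> B *m B^T \in unitmx.
Proof.
move=> fB; rewrite -row_free_unit -kermx_eq0; apply/rowV0P => u.
move=> /sub_kermxP; rewrite mulmxA => uBB0.
have uB0 : u *m B = 0.
  have : (u *m B) *m (u *m B)^T = 0 by rewrite trmx_mul mulmxA uBB0 mul0mx.
  move=> /matrixP /(_ 0 0); rewrite !mxE => /eqP.
  rewrite psumr_eq0 => [/allP s0|j _]; last by rewrite [_^T _ _]mxE -expr2 sqr_ge0.
  apply/rowP => j; have := s0 j (mem_index_enum j).
  by rewrite [_^T _ _]mxE mulf_eq0 orbb => /eqP ->; rewrite mxE.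
by apply: (row_free_inj fB); rewrite uB0 mul0mx.
Qed.

Lemma is_pinv_mul (m n r : nat) (C : 'M[R]_(m, r)) (B : 'M[R]_(r, n)) :
    row_free C^T -> row_free B ->
  is_pinv (C *m B)
    (B^T *m invmx (B *m B^T) *m invmx (C^T *m C) *m C^T).
Proof.
move=> fC /gram_unitmx uB; have := gram_unitmx fC; rewrite trmxK => uC.
set G := invmx (B *m B^T); set H := invmx (C^T *m C).
have GB : B *m B^T *m G = 1%:M by exact: mulmxV.
have HC : H *m (C^T *m C) = 1%:M by exact: mulVmx.
have GT : G^T = G by rewrite trmx_inv trmx_mul trmxK.
have HT : H^T = H by rewrite trmx_inv trmx_mul trmxK.
have MX : C *m B *m (B^T *m G *m H *m C^T) = C *m H *m C^T.
  by rewrite !mulmxA -(mulmxA C B) -(mulmxA C (B *m B^T)) GB mulmx1.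
have XM : B^T *m G *m H *m C^T *m (C *m B) = B^T *m G *m B.
  rewrite -!mulmxA; congr (_ *m (_ *m _)).
  by rewrite (mulmxA C^T) mulmxA HC mul1mx.
split.
- by rewrite MX -!mulmxA (mulmxA C^T) (mulmxA H) HC mul1mx.
- rewrite XM -!mulmxA; congr (_ *m (_ *m _)).
  by rewrite !mulmxA GB mul1mx.
- by rewrite MX !trmx_mul trmxK HT mulmxA.
- by rewrite XM !trmx_mul trmxK GT mulmxA.
Qed.

Lemma is_pinv_ex (m n : nat) (M : 'M[R]_(m, n)) : exists X, is_pinv M X.
Proof.
have := @is_pinv_mul _ _ _ (col_base M) (row_base M).
rewrite mulmx_base => h; eexists; apply: h; last exact: row_base_free.
by rewrite /row_free mxrank_tr; exact: col_base_full.
Qed.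

Lemma pinvP (m n : nat) (M : 'M[R]_(m, n)) : is_pinv M (pinv M).
Proof. by have [X MX] := is_pinv_ex M; exact: xgetPex (ex_intro _ X MX). Qed.

Lemma is_pinv_uniq (m n : nat) (M : 'M[R]_(m, n)) (X Y : 'M[R]_(n, m)) :
  is_pinv M X -> is_pinv M Y -> X = Y.
Proof.
move=> [x1 x2 x3 x4] [y1 y2 y3 y4].
have MXY : M *m X = M *m Y.
  by rewrite -{1}y1 -mulmxA -x3 -y3 -trmx_mul mulmxA x1.
have XMY : X *m M = Y *m M.
  by rewrite -{1}y1 -(mulmxA M) mulmxA -x4 -y4 -trmx_mul -mulmxA (mulmxA M) x1.
by rewrite -x2 -mulmxA MXY mulmxA XMY.
Qed.

End MoorePenrose.

Definition is_minimizer (R : realType) (V : Type) (f : V -> R) (S : set V)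
    (x : V) : Prop :=
  S x /\ forall y, S y -> f x <= f y.

Definition objective (R : realType) (n : nat) (W : 'M[R]_n) (x : 'cV[R]_n) : R :=
  (x^T *m (1%:M - W) *m pinv W *m x) 0 0.

Definition feasible (R : realType) (m n : nat) (A : 'M[R]_(m, n)) (W : 'M[R]_n)
    (xi : 'cV[R]_n) : set 'cV[R]_n :=
  [set x | A *m x = A *m xi /\ mxrange W x].

Section RandomMatrices.
Context (d : measure_display) (T : measurableType d) (R : realType).
Variable P : probability T R.

Definition random_matrix (m n : nat) (X : T -> 'M[R]_(m, n)) : Prop :=
  forall i j, measurable_fun setT (fun w => X w i j).

Definition mutually_independent (I : finType) (X : I -> T -> R) : Prop :=
  forall (J : {set I}) (B : I -> set R), (forall i, measurable (B i)) ->
    P (\bigcap_(i in [set` J]) (X i @^-1` B i)) =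
    (\prod_(i in J) P (X i @^-1` B i))%E.

(* The second argument of [normal_prob] is the standard deviation. *)
Definition gaussian_matrix (m n : nat) (A : T -> 'M[R]_(m, n)) : Prop :=
  [/\ random_matrix A,
      forall i j (B : set R), measurable B ->
        pushforward P (fun w => A w i j) B =
        normal_prob 0 (Num.sqrt (m%:R^-1)) B &
      mutually_independent (fun (ij : 'I_m * 'I_n) w => A w ij.1 ij.2)].

(* The sigma-algebra generated by a random matrix, that is, by its entries. *)
Definition sigma_matrix (m n : nat) (X : T -> 'M[R]_(m, n)) : set (set T) :=
  <<s \bigcup_(ij in [set: 'I_m * 'I_n])
        preimage_set_system setT (fun w => X w ij.1 ij.2) measurable >>.

Definition independent_matrices (m n p q : nat) (X : T -> 'M[R]_(m, n))
    (Y : T -> 'M[R]_(p, q)) : Prop :=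
  forall E F : set T, sigma_matrix X E -> sigma_matrix Y F ->
    P (E `&` F) = (P E * P F)%E.

End RandomMatrices.

(* Main.v *)
Require Import Defs.
From HB Require Import structures.
From mathcomp Require Import all_boot all_order all_algebra.
From mathcomp Require Import all_classical all_reals all_analysis.
From mathcomp Require Import measurable_realfun ring lra zify.

Set Implicit Arguments.
Unset Strict Implicit.
Unset Printing Implicit Defensive.

Import Order.TTheory GRing.Theory Num.Theory.
Import numFieldNormedType.Exports.

Local Open Scope classical_set_scope.
Local Open Scope ring_scope.

(* If xi is a minimizer, the first-order condition along the feasible
   directions W z, A W z = 0, puts the vector v = (I - W) xi, as a row, in the
   row space of A W.  Since v != 0 and rank W > m, some A0 whose rows are
   coordinate vectors makes the rows of v^T and A0 W linearly independent, so
   some maximal minor of the bordered matrix (v^T; A W) is a nonzero polynomial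
   in the entries of A, of degree at most 1 in each of them.  Replacing the
   entries of A0 by those of A one at a time, each step loses the nonvanishing
   of this minor only if the new entry equals the root of a nonconstant affine
   function determined by W and the other entries; as the entry is atomless and
   independent of these, this has probability 0. *)

(** * Linear algebra: bordered minors and the first-order condition *)

Lemma row_free_colsub_unitmx (F : fieldType) (m n : nat) (M : 'M[F]_(m, n)) :
  row_free M -> exists f : {ffun 'I_m -> 'I_n}, colsub f M \in unitmx.
Proof.
move=> fM; have fMT : row_full M^T by rewrite /row_full mxrank_tr.
exists (fullrankfun fMT).
by rewrite -unitmx_tr trmx_mxsub; exact: fullrowsub_unit.
Qed.

(** Modulo the line spanned by [v], the rank of [W] drops by at most one and so stays at least [m].
    Hence [m] rows of [W], picked by [g], are independent modulo [v]. *)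
Lemma row_free_col_mx_rowsub (F : fieldType) (m n : nat) (v : 'rV[F]_n)
    (W : 'M[F]_n) :
    v != 0 -> (m < \rank W)%N ->
  exists g : {ffun 'I_m -> 'I_n}, row_free (col_mx v (rowsub g 1%:M *m W)).
Proof.
move=> v0 mW; pose K := cokermx v.
have rWK : (m <= \rank (W *m K))%N.
  apply: leq_trans (mxrank_mul_min W K).
  by rewrite mxrank_coker rank_rV v0; lia.
pose g : {ffun 'I_m -> 'I_n} :=
  finfun (maxrankfun (W *m K) \o widen_ord rWK).
have gfree : row_free (rowsub g (W *m K)).
  rewrite mxsub_ffunl rowsub_comp.
  have /row_freeP[B KB] := maxrowsub_free (W *m K).
  apply/row_freeP; exists (B *m colsub (widen_ord rWK) 1%:M).
  rewrite mulmxA mul_rowsub_mx KB -mxsub_mul mulmx1.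
  by apply/matrixP => i j; rewrite !mxE -val_eqE.
exists g; rewrite -kermx_eq0; apply/rowV0P => u /sub_kermxP.
rewrite -[u]hsubmxK mul_row_col mul_rowsub_mx mul1mx.
move: (lsubmx u) (rsubmx u) => a l ual.
(* Multiplying by [K] kills [v], so a linear relation descends to the chosen rows of [W *m K]. *)
have l0 : l = 0.
  apply: (row_free_inj gfree); rewrite /= mul0mx -mul_rowsub_mx.
  move: (congr1 (mulmx^~ K) ual); rewrite mul0mx mulmxDl -(mulmxA a).
  by rewrite mulmx_coker mulmx0 add0r mulmxA.
move: ual; rewrite l0 mul0mx addr0 [a]mx11_scalar mul_scalar_mx.
move=> /eqP; rewrite scaler_eq0 (negbTE v0) orbF => /eqP ->.
by rewrite raddf0 row_mx0.
Qed.

Definition set_entry (R : Type) (m n : nat) (p : 'I_m * 'I_n) (x : R)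
    (A : 'M[R]_(m, n)) : 'M[R]_(m, n) :=
  \matrix_(i, j) if (i, j) == p then x else A i j.

(* The minor, on the columns selected by [f], of [A *m W] bordered above by the
   row [v]. *)
Definition border_minor (R : comNzRingType) (m n : nat)
    (f : 'I_(1 + m) -> 'I_n) (v : 'rV[R]_n) (W : 'M[R]_n)
    (A : 'M[R]_(m, n)) : R :=
  \det (colsub f (col_mx v (A *m W))).

(** Only the row [rshift 1 i0] of the bordered matrix involves the entry [p], and it does so
    affinely; the determinant is linear in that row. *)
Lemma border_minor_affine (R : comNzRingType) (m n : nat)
    (f : 'I_(1 + m) -> 'I_n) (v : 'rV[R]_n) (W : 'M[R]_n) (A : 'M[R]_(m, n))
    (p : 'I_m * 'I_n) (x : R) :
  border_minor f v W (set_entry p x A) =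
    (1 - x) * border_minor f v W (set_entry p 0 A) +
    x * border_minor f v W (set_entry p 1 A).
Proof.
case: p => i0 j0.
pose M y := colsub f (col_mx v (set_entry (i0, j0) y A *m W)).
have other y z : row' (rshift 1 i0) (M y) = row' (rshift 1 i0) (M z).
  apply/matrixP => k l; rewrite !mxE; case: splitP => // i kE.
  rewrite !mxE; apply: eq_bigr => j _; rewrite !mxE.
  suff /negPf ii0 : i != i0 by rewrite xpair_eqE ii0.
  apply/eqP => ii0; have /eqP := neq_lift (rshift 1 i0) k; apply.
  by apply: val_inj; move: kE => /= ->; rewrite ii0.
apply: (determinant_multilinear (A := M x) (i0 := rshift 1 i0));
  [|exact: other..].
apply/rowP => k; rewrite !mxE; case: splitP => [i|i /= /addnI/val_inj <-].
  by rewrite (ord1 i).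
rewrite !mxE !mulr_sumr -big_split; apply: eq_bigr => j _ /=; rewrite !mxE.
by case: ifP => _; ring.
Qed.

(** Two distinct roots would make the slope [d - c] vanish, and the minor would be zero at [b] as
    well. *)
Lemma border_minor_root_uniq (F : fieldType) (m n : nat)
    (f : 'I_(1 + m) -> 'I_n) (v : 'rV[F]_n) (W : 'M[F]_n) (A : 'M[F]_(m, n))
    (p : 'I_m * 'I_n) (b x y : F) :
    border_minor f v W (set_entry p b A) != 0 ->
    border_minor f v W (set_entry p x A) = 0 ->
    border_minor f v W (set_entry p y A) = 0 ->
  x = y.
Proof.
rewrite (border_minor_affine _ _ _ _ _ b) (border_minor_affine _ _ _ _ _ x).
rewrite (border_minor_affine _ _ _ _ _ y).
set c := border_minor _ _ _ _; set d := border_minor _ _ _ _ => nz0 x0 y0.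
have /eqP : (x - y) * (d - c) = 0.
  by transitivity ((1 - x) * c + x * d - ((1 - y) * c + y * d));
    [ring|rewrite x0 y0 subrr].
rewrite mulf_eq0 !subr_eq0 => /orP[/eqP //|/eqP dc].
move: nz0 x0; rewrite dc; set e := (_ + _) => e0 eE; case/eqP: e0.
by rewrite -[RHS]eE /e; ring.
Qed.

(** Row independence yields a feasible direction [h] along which the objective has derivative 2 at
    [xi], so a small step backwards decreases it. *)
Lemma not_minimizer_of_row_free (R : realType) (m n : nat) (A : 'M[R]_(m, n))
    (W : 'M[R]_n) (xi : 'cV[R]_n) :
    W^T = W -> mxrange W xi ->
    row_free (col_mx ((1%:M - W) *m xi)^T (A *m W)) ->
  ~ is_minimizer (objective W) (feasible A W xi) xi.
Proof.
move=> WT [eta _ etaE] /row_freeP[B MB] [_ xi_min].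
set V := 1%:M - W in MB *; set v := V *m xi in MB.
have [WPW _ _ _] := pinvP W; set Q := Defs.pinv W in WPW.
have objectiveE x : objective W x = (x^T *m V *m Q *m x) 0 0 by [].
have VT : V^T = V by rewrite linearB /= trmx1 WT.
have VW : W *m V = V *m W by rewrite mulmxBl mulmxBr mul1mx mulmx1.
clearbody V Q.
(* The right inverse [B] solves the system [v^T *m z = 1], [A *m W *m z = 0]. *)
pose z := B *m col_mx 1%:M 0.
have /eq_col_mx[vz AWz] : col_mx (v^T *m z) (A *m W *m z) =
    col_mx (1%:M : 'M[R]_1) (0 : 'cV[R]_m).
  by rewrite -mul_col_mx /z mulmxA MB mul1mx.
pose h := W *m z.
(* Since [xi = W *m eta] and [V] commutes with [W], both cross terms contain [W *m Q *m W], which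
   collapses to [W] and leaves the pairing of [v] with [z]. *)
have hxi : h^T *m V *m Q *m xi = 1%:M.
  rewrite /h trmx_mul WT -etaE -(mulmxA _ W V) VW -!mulmxA (mulmxA Q).
  rewrite (mulmxA W (Q *m W)) (mulmxA W Q) WPW etaE.
  by rewrite -[LHS]trmxK trmx_mul trmxK vz trmx1.
have xih : xi^T *m V *m Q *m h = 1%:M.
  rewrite -etaE trmx_mul WT /h -(mulmxA _ W V) VW -!mulmxA (mulmxA Q).
  rewrite (mulmxA W (Q *m W)) (mulmxA W Q) WPW (mulmxA V) -VW.
  by rewrite -vz /v -etaE !trmx_mul WT VT !mulmxA.
pose q := (h^T *m V *m Q *m h) 0 0.
have objE t : objective W (xi + t *: h) = objective W xi + t *+ 2 + t ^+ 2 * q.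
  rewrite !objectiveE.
  have -> : (xi + t *: h)^T = xi^T + t *: h^T.
    by apply/matrixP => i j; rewrite !mxE.
  rewrite !(mulmxDl, mulmxDr) -!scalemxAl -!scalemxAr hxi xih /q.
  move: (_ *m xi) (_ *m h) => a b; rewrite !mxE eqxx.
  by rewrite /= -mulr_natr; ring.
have obj_ge t : 0 <= t *+ 2 + t ^+ 2 * q.
  have : objective W xi <= objective W (xi + t *: h).
    apply: xi_min; split.
      by rewrite mulmxDr -scalemxAr /h mulmxA AWz scaler0 addr0.
    by exists (eta + t *: z) => //; rewrite mulmxDr etaE -scalemxAr.
  by rewrite objE -addrA lerDl.
have q1 : 0 < 1 + `|q| by rewrite ltr_pwDl.
(* With [t = - s^-1] and [q <= s], the quadratic term is at most [s^-1], too small to offset the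
   linear term [- 2 / s]. *)
have := obj_ge (- (1 + `|q|)^-1); rewrite sqrrN; set s := (1 + `|q|) in q1 *.
have sV : 0 < s^-1 by rewrite invr_gt0.
have ss : s * s^-1 = 1 by rewrite divff ?gt_eqF.
have qs : q <= s by rewrite /s (le_trans (ler_norm q)) // lerDr.
have : s^-1 ^+ 2 * q <= s^-1.
  rewrite expr2 -mulrA -[leRHS]mulr1 ler_pM2l // -ss mulrC.
  by rewrite ler_pM2r.
rewrite -mulr_natr; lra.
Qed.

(** * Measurability, product laws and independence *)

Section Probability.
Context (d : measure_display) (T : measurableType d) (R : realType).

Lemma measurable_det d' (T' : measurableType d') (n : nat) (M : T' -> 'M[R]_n) :
  random_matrix M -> measurable_fun setT (fun w => \det (M w)).
Proof.
move=> mM; rewrite /determinant; apply: measurable_sum => s.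
by apply: measurable_funM => //; apply: measurable_prod => i _; exact: mM.
Qed.

Lemma random_matrix_mul d' (T' : measurableType d') (m n p : nat)
    (M : T' -> 'M[R]_(m, n)) (N : T' -> 'M[R]_(n, p)) :
  random_matrix M -> random_matrix N -> random_matrix (fun w => M w *m N w).
Proof.
move=> mM mN i j; under eq_fun do rewrite mxE.
by apply: measurable_sum => k; apply: measurable_funM; [exact: mM|exact: mN].
Qed.

Lemma measurable_border_minor d' (T' : measurableType d') (m n : nat)
    (f : 'I_(1 + m) -> 'I_n) (v : T' -> 'rV[R]_n) (W : T' -> 'M[R]_n)
    (A : T' -> 'M[R]_(m, n)) :
    random_matrix v -> random_matrix W -> random_matrix A ->
  measurable_fun setT (fun w => border_minor f (v w) (W w) (A w)).
Proof.
move=> mv mW mA; apply: measurable_det => i j.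
under eq_fun do rewrite !mxE.
case: splitP => k _; first exact: mv.
exact: random_matrix_mul.
Qed.

(** Independence makes the law of [(Y, X)] the product of the two laws, and the product measure of
    [D] integrates the measures of its sections. [T'] is arbitrary so that [Y] may be the identity
    onto a coarser sigma-algebra. *)
Lemma indep_null_section (P : probability T R) d' (T' : measurableType d')
    (Y : T -> T') (X : T -> R) (D : set (T' * R)) :
    measurable_fun setT Y -> measurable_fun setT X -> measurable D ->
    (forall E B, measurable E -> measurable B ->
       P (Y @^-1` E `&` X @^-1` B) = (P (Y @^-1` E) * P (X @^-1` B))%E) ->
    (forall y, P (X @^-1` xsection D y) = 0%E) ->
  P [set w | D (Y w, X w)] = 0%E.
Proof.
move=> mY mX mD XY D0.
have mYX : measurable_fun setT (fun w => (Y w, X w)).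
  exact: measurable_fun_pair.
pose Ym : {mfun T >-> T'} := mfun_Sub (mem_set mY).
pose Xm : {mfun T >-> R} := mfun_Sub (mem_set mX).
pose YXm : {mfun T >-> (T' * R)%type} := mfun_Sub (mem_set mYX).
transitivity (distribution P YXm D); first by [].
rewrite -(@product_measure_unique _ _ _ _ _ (distribution P Ym)
  (distribution P Xm) (distribution P YXm)) //.
by rewrite /product_measure1; apply: integral0_eq => y _; exact: D0.
Qed.

(** Dynkin's pi-lambda argument: the events independent of [H] form a Dynkin system containing the
    pi-system [G]. *)
Lemma g_sigma_algebra_indep (P : probability T R) (G : set (set T))
    (H : set T) :
    measurable H -> G `<=` measurable -> setI_closed G ->
    (forall E, G E -> P (E `&` H) = (P E * P H)%E) ->
  forall E, <<s G >> E -> P (E `&` H) = (P E * P H)%E.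
Proof.
move=> mH mG GI GH.
suff : <<s G >> `<=` [set E | measurable E /\ P (E `&` H) = (P E * P H)%E].
  by move=> sub E /sub[].
rewrite -setI_closed_g_dynkin_g_sigma_algebra//.
apply: smallest_sub; last first.
  by move=> E GE; split; [exact: mG|exact: GH].
split.
- by split=> //; rewrite setTI probability_setT mul1e.
- move=> E [mE EH]; split; first exact: measurableC.
  have -> : P (~` E `&` H) = (P H - P E * P H)%E.
    rewrite -EH setIC -setDE [E `&` H]setIC; apply: measureD => //.
    by rewrite ltey_eq fin_num_measure.
  by rewrite probability_setC// muleBl ?mul1e ?fin_num_measure.
- move=> F tF FH; have mF n := (FH n).1.
  split; first exact: bigcup_measurable.
  rewrite setI_bigcupl !measure_bigcup//; last 2 first.
  - by move=> n _; exact: measurableI.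
  - exact: trivIset_setIr.
  rewrite muleC -(fineK (fin_num_measure P H mH)) -nneseriesZl//.
  apply: eq_eseriesr => n _.
  transitivity (P (F n) * P H)%E; first exact: (FH n).2.
  by rewrite muleC fineK ?fin_num_measure.
Qed.

End Probability.

(** * Almost sure nonvanishing of the bordered minor *)

Section Genericity.
Context (d : measure_display) (T : measurableType d) (R : realType).
Context (P : probability T R) (m n : nat).
Context (A : T -> 'M[R]_(m, n)) (W : T -> 'M[R]_n).
Context (A_gaussian : gaussian_matrix P A) (W_random : random_matrix W)
  (AW_indep : independent_matrices P A W).

Let entry (q : 'I_m * 'I_n) : T -> R := fun w => A w q.1 q.2.

Let A_random : random_matrix A. Proof. by case: A_gaussian. Qed.

(* A pi-system generating the sigma-algebra of [W] and of all entries of [A]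
   other than the entry [p]. *)
Definition all_but_entry (p : 'I_m * 'I_n) : set (set T) :=
  [set E | exists (B : 'I_m * 'I_n -> set R) (F : set T),
    [/\ forall q, measurable (B q), sigma_matrix W F &
        E = \bigcap_(q in [set` [set~ p]%SET]) (entry q @^-1` B q) `&` F]].

Lemma sigma_matrix_measurable (k l : nat) (X : T -> 'M[R]_(k, l)) :
  random_matrix X -> sigma_matrix X `<=` measurable.
Proof.
move=> mX; apply: smallest_sub; first exact: sigma_algebra_measurable.
by move=> _ [q _] [B mB <-]; exact: mX.
Qed.

Lemma sigma_matrix_entry (k l : nat) (X : T -> 'M[R]_(k, l)) i j (B : set R) :
  measurable B -> sigma_matrix X ((fun w => X w i j) @^-1` B).
Proof.
by move=> mB; apply: sub_sigma_algebra; exists (i, j) => //; exists B;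
  rewrite ?setTI.
Qed.

Lemma all_but_entry_measurable p : all_but_entry p `<=` measurable.
Proof.
move=> _ [B [F [mB mF ->]]]; apply: measurableI.
  apply: fin_bigcap_measurable => // q _; rewrite -[X in measurable X]setTI.
  exact: A_random.
exact: sigma_matrix_measurable mF.
Qed.

(** The identity into the coarser space serves as a single random variable carrying [W] and all
    entries of [A] but [p]. *)
Lemma measurable_id_all_but_entry p :
  measurable_fun setT (id : T -> g_sigma_algebraType (all_but_entry p)).
Proof.
move=> _ E mE; rewrite setTI; move: E mE; apply: smallest_sub.
  exact: sigma_algebra_measurable.
exact: all_but_entry_measurable.
Qed.

Lemma setI_closed_all_but_entry p : setI_closed (all_but_entry p).
Proof.
move=> _ _ [B [F [mB mF ->]]] [C [G [mC mG ->]]].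
exists (fun q => B q `&` C q), (F `&` G); split.
- by move=> q; exact: measurableI.
- exact: (@measurableI _ (g_sigma_algebraType _)).
- by rewrite setIACA; congr (_ `&` _); rewrite -bigcapI.
Qed.

(** On the generating pi-system, independence of [A] and [W] splits off [F], then mutual
    independence of the entries splits off [p]. *)
Lemma all_but_entry_indep p (C : set R) (E : set T) :
    measurable C -> <<s all_but_entry p >> E ->
  P (E `&` entry p @^-1` C) = (P E * P (entry p @^-1` C))%E.
Proof.
have [_ _ Aind] := A_gaussian => mC.
apply: g_sigma_algebra_indep.
- by rewrite -[X in measurable X]setTI; exact: A_random.
- exact: all_but_entry_measurable.
- exact: setI_closed_all_but_entry.
move=> _ [B [F [mB mF ->]]].
have sA (J : {set 'I_m * 'I_n}) (D : 'I_m * 'I_n -> set R) :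
    (forall q, measurable (D q)) ->
  sigma_matrix A (\bigcap_(q in [set` J]) (entry q @^-1` D q)).
  move=> mD; apply: (@fin_bigcap_measurable _ (g_sigma_algebraType _)) => //.
  by move=> q _; exact: sigma_matrix_entry.
(* Placing [C] at position [p] turns the event into one intersection over all entries. *)
pose D q := if q == p then C else B q.
have mD q : measurable (D q) by rewrite /D; case: ifP.
rewrite setIAC.
have -> : \bigcap_(q in [set` [set~ p]%SET]) (entry q @^-1` B q) `&`
    entry p @^-1` C =
    \bigcap_(q in [set` [set: 'I_m * 'I_n]%SET]) (entry q @^-1` D q).
  apply/seteqP; split=> w.
    move=> [Bw Cw] q _; rewrite /= /D; case: eqP => [->//|/eqP qp].
    by apply: Bw => /=; rewrite !inE.
  move=> Dw; split.
    move=> q /=; rewrite !inE => /negPf qp.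
    by have := Dw q; rewrite /= /D qp; apply; rewrite inE.
  by have := Dw p; rewrite /= /D eqxx; apply; rewrite inE.
rewrite !AW_indep//; [|exact: sA..].
rewrite muleAC; congr (_ * _)%E.
rewrite !Aind // (bigD1 p) ?inE //= muleC /D eqxx; congr (_ * _)%E.
apply: eq_big => q; first by rewrite !inE andTb.
by rewrite inE => /negPf ->.
Qed.

Lemma measurable_all_but_entry p q : q != p ->
  measurable_fun setT (entry q : g_sigma_algebraType (all_but_entry p) -> R).
Proof.
move=> qp _ B mB; apply: sub_sigma_algebra.
exists (fun r => if r == q then B else setT), setT; split.
- by move=> r; case: ifP.
- exact: (@measurableT _ (g_sigma_algebraType _)).
- rewrite setTI setIT; apply/seteqP; split=> w /=.
    by move=> Bw r _ /=; case: eqP => [->|].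
  by move=> /(_ q) /=; rewrite eqxx !inE; apply.
Qed.

Lemma random_matrix_all_but_entry p :
  random_matrix (W : g_sigma_algebraType (all_but_entry p) -> 'M[R]_n).
Proof.
move=> i j _ B mB; apply: sub_sigma_algebra.
exists (fun=> setT), ((fun w => W w i j) @^-1` B); split => //.
- exact: sigma_matrix_entry.
- by congr (_ `&` _); apply/seteqP; split.
Qed.

Context (xi : 'cV[R]_n).
Let v (w : T) : 'rV[R]_n := ((1%:M - W w) *m xi)^T.

Lemma random_matrix_residual d' (T' : measurableType d') (U : T' -> 'M[R]_n) :
  random_matrix U -> random_matrix (fun w => ((1%:M - U w) *m xi)^T).
Proof.
move=> mU i j; under eq_fun do rewrite mxE.
apply: (random_matrix_mul (N := fun=> xi)).
  move=> k l; under eq_fun do rewrite !mxE.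
  by apply: measurable_funB => //; exact: mU.
by move=> k l; exact: measurable_cst.
Qed.

Definition partial_mx (s : seq ('I_m * 'I_n)) (A B : 'M[R]_(m, n)) :
    'M[R]_(m, n) :=
  \matrix_(i, j) if (i, j) \in s then A i j else B i j.

Lemma partial_mx_cons s p (B C : 'M[R]_(m, n)) : partial_mx (p :: s) B C =
  set_entry p (B p.1 p.2) (partial_mx s B C).
Proof.
apply/matrixP => i j; rewrite !mxE inE.
by have [<-|] := eqVneq (i, j) p.
Qed.

Lemma set_entry_partial_mx s p (B C : 'M[R]_(m, n)) : p \notin s ->
  set_entry p (C p.1 p.2) (partial_mx s B C) = partial_mx s B C.
Proof.
case: p => k l ps; apply/matrixP => i j; rewrite !mxE.
by have [[-> ->]|//] := eqVneq (i, j) (k, l); rewrite (negbTE ps).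
Qed.

Lemma ae_set_entry_neq0 (f : 'I_(1 + m) -> 'I_n) (B : T -> 'M[R]_(m, n))
    (p : 'I_m * 'I_n) (b : R) :
    (forall q, q != p -> measurable_fun setT
       (fun w : g_sigma_algebraType (all_but_entry p) => B w q.1 q.2)) ->
  {ae P, forall w, border_minor f (v w) (W w) (set_entry p b (B w)) != 0 ->
    border_minor f (v w) (W w) (set_entry p (entry p w) (B w)) != 0}.
Proof.
move=> mB; pose T' := g_sigma_algebraType (all_but_entry p).
pose g (c : T' * R -> R) (z : T' * R) :=
  border_minor f (v z.1) (W z.1) (set_entry p (c z) (B z.1)).
have mg c : measurable_fun setT c -> measurable_fun setT (g c).
  move=> mc.
  have mW : random_matrix (fun z : T' * R => W z.1).
    move=> i j; apply: (measurableT_comp (f := fun w : T' => W w i j)) => //.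
    exact: random_matrix_all_but_entry.
  have mv := random_matrix_residual mW.
  apply: (measurable_border_minor f mv mW).
  move=> i j; under eq_fun do rewrite mxE.
  have [_ //|ijp] := eqVneq (i, j) p.
  apply: (measurableT_comp (f := fun w : T' => B w i j)) => //.
  exact: mB ijp.
(* The bad set: the minor is nonzero with [b] at position [p] but zero with the new value there. *)
pose D := g (fun=> b) @^-1` [set~ 0] `&` g snd @^-1` [set 0].
have mD : measurable D.
  apply: measurableI; rewrite -[X in measurable X]setTI; apply: mg => //.
  exact: measurableC.
exists [set w | D (w, entry p w)]; split.
- rewrite -[X in measurable X]setTI.
  have : measurable_fun setT (fun w : T => (w : T', entry p w)).
    apply: measurable_fun_pair; last exact: A_random.
    exact: measurable_id_all_but_entry.
  exact.
- apply: (@indep_null_section _ _ _ P _ T' id (entry p) D) => //.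
  + exact: measurable_id_all_but_entry.
  + exact: A_random.
  + by move=> E C mE mC; exact: all_but_entry_indep.
  + move=> w; have [_ Alaw _] := A_gaussian.
    have := Alaw p.1 p.2 _ (measurable_xsection w mD).
    rewrite /pushforward => ->.
    (* With the other data frozen, the bad values are roots of one nonzero affine function, so the
       section has at most one point and the Gaussian integral over it is zero. *)
    have [->|/set0P[x Dx]] := eqVneq (xsection D w) set0; first exact: measure0.
    apply: (@integral_Sset1 _ _ _ x) => y.
    move: Dx; rewrite /xsection /= !inE => -[b0 x0] [_ y0].
    exact: (border_minor_root_uniq (introN eqP b0) y0 x0).
- move=> w /= /not_implyP[b0 /negP]; rewrite negbK => /eqP X0.
  by split => //=; apply/eqP.
Qed.

Lemma ae_border_minor_neq0 (f : 'I_(1 + m) -> 'I_n) (C : 'M[R]_(m, n)) :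
  {ae P, forall w, border_minor f (v w) (W w) C != 0 ->
    border_minor f (v w) (W w) (A w) != 0}.
Proof.
(* Induction on the list [s] of positions already filled from [A]; the list of all positions gives
   [A] itself. *)
suff : forall s, {ae P, forall w, border_minor f (v w) (W w) C != 0 ->
    border_minor f (v w) (W w) (partial_mx s (A w) C) != 0}.
  move=> /(_ (enum {: 'I_m * 'I_n})); apply: filterS => w.
  congr (_ -> border_minor _ _ _ _ != 0).
  by apply/matrixP => i j; rewrite mxE mem_enum.
elim=> [|p s IH].
  apply: aeW => w; congr (border_minor _ _ _ _ != 0).
  by apply/matrixP => i j; rewrite mxE.
have [ps|ps] := boolP (p \in s).
  apply: filterS IH => w; congr (_ -> border_minor _ _ _ _ != 0).
  apply/matrixP => i j; rewrite !mxE inE.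
  by have [->|] := eqVneq (i, j) p; rewrite ?ps.
have mB q : q != p -> measurable_fun setT
    (fun w : g_sigma_algebraType (all_but_entry p) =>
       partial_mx s (A w) C q.1 q.2).
  move=> qp; under eq_fun do rewrite mxE.
  case: (_ \in s); [exact: measurable_all_but_entry|exact: measurable_cst].
(* As [p] is not in [s], the hybrid matrix still has the value of [C] at [p], which is the base
   point [b] of the replacement step. *)
apply: filterS2 IH (ae_set_entry_neq0 f (C p.1 p.2) mB) => w IHw.
rewrite set_entry_partial_mx// => step /IHw/step.
by rewrite partial_mx_cons.
Qed.

End Genericity.

Theorem theorem2p1 (d : measure_display) (T : measurableType d) (R : realType)
  (P : probability T R) (m n : nat) (m_gt0 : (0 < m)%N) (n_gt0 : (0 < n)%N)
  (A : T -> 'M[R]_(m, n)) (W : T -> 'M[R]_n) (xi : 'cV[R]_n)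
  (A_gaussian : gaussian_matrix P A)
  (W_random : random_matrix W)
  (W_sym : {ae P, forall w, (W w)^T = W w})
  (W_eig : {ae P, forall w, forall a : R, eigenvalue (W w) a -> 0 <= a <= 1})
  (AW_indep : independent_matrices P A W)
  (xi_range : {ae P, forall w, mxrange (W w) xi})
  (m_lt_rank : {ae P, forall w, (m < \rank (W w))%N})
  (xi_null : {ae P, forall w, ~ mxnull (1%:M - W w) xi}) :
  {ae P, forall w,
    ~ is_minimizer (objective (W w)) (feasible (A w) (W w) xi) xi}.
Proof.
(* The selections [f] and [g] will depend on [w] through [W w]; as they range over finite types, one
   null set serves for all of them. *)
have ae_minor : {ae P, forall w, forall (f : {ffun 'I_(1 + m) -> 'I_n})
    (g : {ffun 'I_m -> 'I_n}),
    border_minor f ((1%:M - W w) *m xi)^T (W w) (rowsub g 1%:M) != 0 ->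
    border_minor f ((1%:M - W w) *m xi)^T (W w) (A w) != 0}.
  apply: filter_forall => f; apply: filter_forall => g.
  exact: (ae_border_minor_neq0 A_gaussian W_random AW_indep).
have ae_W : {ae P, forall w, [/\ (W w)^T = W w, mxrange (W w) xi,
    (m < \rank (W w))%N & ~ mxnull (1%:M - W w) xi]}.
  apply: filterS3 (filterI W_sym xi_range) m_lt_rank xi_null.
  by move=> w [].
apply: filterS2 ae_minor ae_W => w minorA [WT xiW mW /eqP xiN].
have v0 : ((1%:M - W w) *m xi)^T != 0 by rewrite trmx_eq0.
have [g gfree] := row_free_col_mx_rowsub v0 mW.
have [f] := row_free_colsub_unitmx gfree.
rewrite unitmxE unitfE => /minorA fA.
apply: not_minimizer_of_row_free => //.
apply/row_freeP; set M := col_mx _ _.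
(* Inverting the square block on the columns [f] and padding with zero rows gives a right inverse of
   the whole bordered matrix. *)
exists (colsub f 1%:M *m invmx (colsub f M)).
by rewrite mulmxA mulmx_colsub mulmx1 mulmxV// unitmxE unitfE.
Qed.
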